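(* Let $\Gamma=\langle\alpha_1,\dots,\alpha_e\rangle\subsetneq\mathbb{N}$, with minimal generators $\alpha_1<\dots<\alpha_e$, be a numerical semigroup that is either monomial or of the form $\langle\alpha_1,\alpha_2\rangle$ with $\gcd(\alpha_1,\alpha_2)=1$. Let $c$ be its conductor, and let $n^*$ be a truncation bound for which $\Gamma_{\le n^*}=\Gamma\cap[0,n^*]$ suffices for the algorithm $\mathcal{A}$ described in the context. Let $\chi_\ell=\#\mathscr{D}_\ell$ be the number of $\Gamma$-subsemimodules $\Delta\subseteq\Gamma$ with $\#(\Gamma\setminus\Delta)=\ell$. Then the time complexity of $\mathcal{A}$, which computes the motivic Hilbert zeta function up to order $c$ of the curve singularity with complete local ring $\mathbb{C}[[t^{\alpha_1},\dots,t^{\alpha_e}]]$, is $$\sum_{\ell=1}^{c}O\bigl(c\cdot\chi_\ell\cdot n^*\cdot\alpha_1\cdot(n^*-\ell)\bigr).$$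
   Context: $\mathbb{N}=\{0,1,2,\dots\}$. A numerical semigroup is a submonoid of $\mathbb{N}$ with finite complement. Its conductor $c$ is the least integer with $[c,\infty)\cap\mathbb{N}\subseteq\Gamma$. $\Gamma$ is monomial if every reduced irreducible curve singularity with value semigroup $\Gamma$ has local ring isomorphic to $k[[t^{a_1},\dots,t^{a_m}]]$ for some $a_1,\dots,a_m$ with gcd $1$; equivalently (Pfister–Steenbrink) $\Gamma$ is one of: $\{im\mid0\le i\le s\}\cup[sm+b,\infty)$ with $1\le b<m$, $s\ge1$; $\{0\}\cup[m,m+r-1]\cup[m+r+1,\infty)$ with $2\le r\le m-1$; $\{0,m\}\cup[m+2,2m]\cup[2m+2,\infty)$ with $m\ge3$. A $\Gamma$-subsemimodule is a subset $\Delta\subseteq\Gamma$ with $\Delta+\Gamma\subseteq\Delta$. $T_\Delta$ is its unique minimal generating set, i.e. the smallest set with $\Delta=\bigcup_{\gamma\in T_\Delta}(\gamma+\Gamma)$. $\mathscr{D}_\ell$ is the set of $\Gamma$-subsemimodules $\Delta$ with $\#(\Gamma\setminus\Delta)=\ell$. For $\Delta\ne\Gamma$, $\gamma_\Delta=\max(\Gamma\setminus\Delta)$ and $m(\Delta)=\Delta\cup\{\gamma_\Delta\}$. $\operatorname{Syz}(\Delta)$ is the set of $\sigma\in\Delta$ that lie in $\gamma+\Gamma$ for at least two distinct $\gamma\in T_\Delta$, and $T_{\operatorname{Syz}(\Delta)}$ is its minimal generating set as a $\Gamma$-semimodule. $C^{[\Delta]}$ denotes the variety of ideals $I$ of $\mathbb{C}[[t^{\alpha_1},\dots,t^{\alpha_e}]]$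 whose set of $t$-adic orders of nonzero elements is $\Delta$. $[\cdot]$ is the class in the Grothendieck ring $K_0(\mathrm{Var}_{\mathbb{C}})$, and $\mathbb{L}$ is the class of the affine line. Algorithm $\mathcal{A}$ (every semimodule $\Delta$ is represented by the finite set $\Delta\cap[0,n^*]$): 1. (Tree) $\mathscr{D}_1=\{\Gamma\setminus\{0\}\}$. For $\ell=1,\dots,c-1$, $\mathscr{D}_{\ell+1}$ is the set of all $\Delta\setminus\{\gamma\}$ with $\Delta\in\mathscr{D}_\ell$, $\gamma\in T_\Delta$, where $T_\Delta$ is computed by subroutine (a). 2. For $\ell=1,\dots,c$ and each $\Delta\in\mathscr{D}_\ell$: compute $\gamma_\Delta$; compute $T_\Delta$ by (a), $\operatorname{Syz}(\Delta)$ by (b), and $T_{\operatorname{Syz}(\Delta)}$ by (a); compute $C_1=\#\{\gamma\in T_\Delta\mid\gamma<\gamma_\Delta\}$ and $C_2=\#\{\sigma\in T_{\operatorname{Syz}(\Delta)}\mid\sigma<\gamma_\Delta\}$; set $[C^{[\Delta]}]=[C^{[m(\Delta)]}]\cdot\mathbb{L}^{C_1-C_2}$ (with $[C^{[\Gamma]}]=1$). 3. Return $1+\sum_{\ell=1}^{c}\sum_{\Delta\in\mathscr{D}_\ell}[C^{[\Delta]}]q^\ell$. Subroutines: (a) minimal generators of $\{a_1<\dots<a_s\}$: start with $T=\{a_1\}$; for $i=2,\dots,s$ run through $x\in T$, testing whether $a_i-x\in\Gamma$ and stopping as soon as a test succeeds; if no test succeeds, add $a_i$ to $T$. (b) $\operatorname{Syz}(\Delta)$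 for $\Delta=\{a_1<\dots<a_s\}$ with generators $\gamma_1,\dots,\gamma_m$: for each $a_i$ run through the $\gamma_j$, testing whether $a_i-\gamma_j\in\Gamma$, and include $a_i$ once two tests have succeeded. ''Suffices'' means the output with the truncated set equals the true series $1+\sum_{\ell=1}^c\sum_{\Delta\in\mathscr{D}_\ell}[C^{[\Delta]}]q^\ell$, all semimodules occurring being faithfully represented, in particular $\Gamma\setminus\Delta\subseteq[0,n^*]$ for them. Cost model: a membership test in $\Gamma_{\le n^*}$ costs $O(n^* )$; deleting an element from a stored $\Delta$, inserting a semimodule into a stored collection, looking up an already computed class, and one arithmetic operation on integers or on classes each cost $O(1)$. Implied constants are absolute; a sum of $O(\cdot)$ terms means the total cost is at most an absolute constant times the sum of the expressions inside. *)

(* Defs.v *)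
From HB Require Import structures.
From mathcomp Require Import all_boot all_order all_algebra.
From mathcomp Require Import finmap.
From mathcomp Require Import boolp classical_sets functions cardinality.
From mathcomp Require Import reals Rstruct complex.
From mathcomp Require Import mpoly.

Set Implicit Arguments.
Unset Strict Implicit.
Unset Printing Implicit Defensive.

Import GRing.Theory.

Local Open Scope classical_set_scope.
Local Open Scope ring_scope.
Local Open Scope quotient_scope.

Definition numerical_semigroup (Gamma : set nat) : Prop :=
  [/\ Gamma 0%N,
      forall x y, Gamma x -> Gamma y -> Gamma (x + y)%N
    & finite_set (~` Gamma)].

Definition monoid_span (alpha : seq nat) : set nat :=
  [set n | exists k : nat -> nat, n = (\sum_(a <- alpha) k a * a)%N].

Definition minimal_generators (alpha : seq nat) (Gamma : set nat) : Prop :=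
  [/\ sorted ltn alpha,
      Gamma = monoid_span alpha
    & forall a, a \in alpha -> ~ monoid_span (rem a alpha) a].

Definition is_conductor (Gamma : set nat) (c : nat) : Prop :=
  (forall n, (c <= n)%N -> Gamma n) /\
  (forall c', (forall n, (c' <= n)%N -> Gamma n) -> (c <= c')%N).

Definition subsemimodule (Gamma Delta : set nat) : Prop :=
  Delta `<=` Gamma /\
  (forall d g, Delta d -> Gamma g -> Delta (d + g)%N).

Definition semimodules (Gamma : set nat) (l : nat) : set (set nat) :=
  [set Delta | subsemimodule Gamma Delta /\ (Gamma `\` Delta #= `I_l)%card].

Definition chi (Gamma : set nat) (l : nat) : nat :=
  #|` fset_set (semimodules Gamma l)|.

(** The default value 0 is only used when the maximum does not exist. *)
Definition max_gap (Gamma Delta : set nat) : nat :=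
  xget 0%N [set g | (Gamma `\` Delta) g /\
                    forall x, (Gamma `\` Delta) x -> (x <= g)%N].

Notation C := (complex Rdefinitions.R).

Definition series : Type := nat -> C.

Definition saddp (f g : series) : series := fun n => f n + g n.

Definition smulp (f g : series) : series :=
  fun n => \sum_(i < n.+1) f i * g (n - i)%N.

Definition sconst (a : C) : series := fun n => if n == 0%N then a else 0.

Definition orders (I : set series) : set nat :=
  [set n | exists f, [/\ I f, f n != 0 & forall i, (i < n)%N -> f i = 0]].

(** For [Gamma] generated by [alpha_1, ..., alpha_e] this is
    [C[[t^alpha_1, ..., t^alpha_e]]]. *)
Definition semigroup_ring (Gamma : set nat) : set series :=
  [set f | forall n, f n != 0 -> Gamma n].

Definition is_ideal (Gamma : set nat) (I : set series) : Prop :=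
  [/\ I `<=` semigroup_ring Gamma,
      I (sconst 0),
      forall f g, I f -> I g -> I (saddp f g)
    & forall g f, semigroup_ring Gamma g -> I f -> I (smulp g f)].

(** Complete local rings of reduced irreducible curve singularities, embedded
    in their normalization [C[[t]]]: the subalgebras
    that contain a power of the maximal ideal of [C[[t]]]. *)
Definition branch_ring (A : set series) : Prop :=
  [/\ forall a, A (sconst a),
      forall f g, A f -> A g -> A (saddp f g),
      forall f g, A f -> A g -> A (smulp f g)
    & exists N, forall f : series, (forall i, (i < N)%N -> f i = 0) -> A f].

Definition algebra_iso (A B : set series) : Prop :=
  exists phi psi : series -> series,
    [/\ forall f, A f -> B (phi f) /\ psi (phi f) = f,
        forall g, B g -> A (psi g) /\ phi (psi g) = g,
        forall f g, A f -> A g -> phi (saddp f g) = saddp (phi f) (phi g),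
        forall f g, A f -> A g -> phi (smulp f g) = smulp (phi f) (phi g)
      & forall a, phi (sconst a) = sconst a].

Definition monomial_semigroup (Gamma : set nat) : Prop :=
  forall A, branch_ring A -> orders A = Gamma ->
  exists a : seq nat, \big[gcdn/0%N]_(x <- a) x = 1%N /\
                      algebra_iso A (semigroup_ring (monoid_span a)).

(** Every variety is a finite disjoint union of locally closed subvarieties
    of affine spaces, so the classes of the latter, with the usual relations,
    present [K_0(Var)]. *)

Definition zeros n (P : set {mpoly C[n]}) : set ('I_n -> C) :=
  [set x | forall p, P p -> p.@[x] = 0].

Definition locally_closed n (S : set ('I_n -> C)) : Prop :=
  exists P Q, S = zeros P `\` zeros Q.

Record variety := Variety {
  ambient_dim : nat;
  points : set ('I_ambient_dim -> C);
  points_locally_closed : locally_closed points }.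

Arguments points : clear implicits.

Definition regular_function (X : variety)
    (f : ('I_(ambient_dim X) -> C) -> C) : Prop :=
  forall x, points X x -> exists p q : {mpoly C[ambient_dim X]}, q.@[x] != 0 /\
    forall y, points X y -> q.@[y] != 0 -> f y = p.@[y] / q.@[y].

Definition regular_map (X Y : variety)
    (f : ('I_(ambient_dim X) -> C) -> 'I_(ambient_dim Y) -> C) : Prop :=
  (forall x, points X x -> points Y (f x)) /\
  (forall i, regular_function (X := X) (fun x => f x i)).

Definition isomorphic (X Y : variety) : Prop :=
  exists f g, [/\ regular_map (X := X) (Y := Y) f,
                  regular_map (X := Y) (Y := X) g,
                  forall x, points X x -> g (f x) = x
                & forall y, points Y y -> f (g y) = y].

Inductive K0term :=
  | K0class of variety
  | K0zero
  | K0one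
  | K0opp of K0term
  | K0add of K0term & K0term
  | K0mul of K0term & K0term.

Inductive K0rel : K0term -> K0term -> Prop :=
  | K0rel_iso X Y : isomorphic X Y -> K0rel (K0class X) (K0class Y)
  | K0rel_scissors n (S Z U : set ('I_n -> C)) (hS : locally_closed S)
      (hZ : locally_closed Z) (hU : locally_closed U) :
      (exists P, Z = S `&` zeros P) -> U = S `\` Z ->
      K0rel (K0class (Variety hS))
            (K0add (K0class (Variety hZ)) (K0class (Variety hU)))
  | K0rel_prod m n (S : set ('I_m -> C)) (T : set ('I_n -> C))
      (P : set ('I_(m + n) -> C)) (hS : locally_closed S)
      (hT : locally_closed T) (hP : locally_closed P) :
      P = [set w | S (fun i => w (lshift n i)) /\
                   T (fun i => w (rshift m i))] ->
      K0rel (K0class (Variety hP))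
            (K0mul (K0class (Variety hS)) (K0class (Variety hT)))
  | K0rel_point (h : locally_closed [set: 'I_0 -> C]) :
      K0rel (K0class (Variety h)) K0one
  | K0rel_refl x : K0rel x x
  | K0rel_sym x y : K0rel x y -> K0rel y x
  | K0rel_trans y x z : K0rel x y -> K0rel y z -> K0rel x z
  | K0rel_opp x x' : K0rel x x' -> K0rel (K0opp x) (K0opp x')
  | K0rel_add x x' y y' :
      K0rel x x' -> K0rel y y' -> K0rel (K0add x y) (K0add x' y')
  | K0rel_mul x x' y y' :
      K0rel x x' -> K0rel y y' -> K0rel (K0mul x y) (K0mul x' y')
  | K0rel_addA x y z :
      K0rel (K0add x (K0add y z)) (K0add (K0add x y) z)
  | K0rel_addC x y : K0rel (K0add x y) (K0add y x)
  | K0rel_add0 x : K0rel (K0add K0zero x) x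
  | K0rel_addN x : K0rel (K0add (K0opp x) x) K0zero
  | K0rel_mulA x y z :
      K0rel (K0mul x (K0mul y z)) (K0mul (K0mul x y) z)
  | K0rel_mulC x y : K0rel (K0mul x y) (K0mul y x)
  | K0rel_mul1 x : K0rel (K0mul K0one x) x
  | K0rel_mulD x y z :
      K0rel (K0mul (K0add x y) z) (K0add (K0mul x z) (K0mul y z)).

HB.instance Definition _ := gen_eqMixin K0term.
HB.instance Definition _ := gen_choiceMixin K0term.

Definition K0relb (x y : K0term) : bool := `[< K0rel x y >].

Lemma K0relb_refl : reflexive K0relb.
Proof. by move=> x; apply/asboolP; exact: K0rel_refl. Qed.

Lemma K0relb_sym : ssrbool.symmetric K0relb.
Proof.
by move=> x y; apply/idP/idP => /asboolP h; apply/asboolP; exact: K0rel_sym.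
Qed.

Lemma K0relb_trans : transitive K0relb.
Proof.
move=> y x z /asboolP h1 /asboolP h2; apply/asboolP.
exact: K0rel_trans h1 h2.
Qed.

Canonical K0relb_equiv :=
  EquivRel K0relb K0relb_refl K0relb_sym K0relb_trans.

Definition K0 : Type := {eq_quot K0relb}.

HB.instance Definition _ := Choice.on K0.
HB.instance Definition _ := EqQuotient.on K0.

Lemma K0_eqP (x y : K0term) : K0rel x y -> \pi_K0 x = \pi_K0 y.
Proof. by move=> h; apply/eqmodP/asboolP. Qed.

Lemma K0_reprP (x : K0term) : K0rel (repr (\pi_K0 x)) x.
Proof.
suff: K0relb (repr (\pi_K0 x)) x by move/asboolP.
by apply/eqmodP; rewrite reprK.
Qed.

Definition K0_add (x y : K0) : K0 := \pi_K0 (K0add (repr x) (repr y)).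
Definition K0_opp (x : K0) : K0 := \pi_K0 (K0opp (repr x)).
Definition K0_mul (x y : K0) : K0 := \pi_K0 (K0mul (repr x) (repr y)).

Lemma K0_addE x y : K0_add (\pi_K0 x) (\pi_K0 y) = \pi_K0 (K0add x y).
Proof. by apply: K0_eqP; apply: K0rel_add; exact: K0_reprP. Qed.

Lemma K0_oppE x : K0_opp (\pi_K0 x) = \pi_K0 (K0opp x).
Proof. by apply: K0_eqP; apply: K0rel_opp; exact: K0_reprP. Qed.

Lemma K0_mulE x y : K0_mul (\pi_K0 x) (\pi_K0 y) = \pi_K0 (K0mul x y).
Proof. by apply: K0_eqP; apply: K0rel_mul; exact: K0_reprP. Qed.

Lemma K0_addA : associative K0_add.
Proof.
elim/quotW=> x; elim/quotW=> y; elim/quotW=> z.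
rewrite (K0_addE y z) (K0_addE x y) (K0_addE x) (K0_addE _ z).
by apply: K0_eqP; exact: K0rel_addA.
Qed.

Lemma K0_addC : commutative K0_add.
Proof.
elim/quotW=> x; elim/quotW=> y.
by rewrite (K0_addE x y) (K0_addE y x); apply: K0_eqP; exact: K0rel_addC.
Qed.

Lemma K0_add0 : left_id (\pi_K0 K0zero) K0_add.
Proof.
by elim/quotW=> x; rewrite K0_addE; apply: K0_eqP; exact: K0rel_add0.
Qed.

Lemma K0_addN : left_inverse (\pi_K0 K0zero) K0_opp K0_add.
Proof.
by elim/quotW=> x; rewrite K0_oppE K0_addE; apply: K0_eqP; exact: K0rel_addN.
Qed.

HB.instance Definition _ :=
  GRing.isZmodule.Build K0 K0_addA K0_addC K0_add0 K0_addN.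

Lemma K0_mulA : associative K0_mul.
Proof.
elim/quotW=> x; elim/quotW=> y; elim/quotW=> z.
rewrite (K0_mulE y z) (K0_mulE x y) (K0_mulE x) (K0_mulE _ z).
by apply: K0_eqP; exact: K0rel_mulA.
Qed.

Lemma K0_mulC : commutative K0_mul.
Proof.
elim/quotW=> x; elim/quotW=> y.
by rewrite (K0_mulE x y) (K0_mulE y x); apply: K0_eqP; exact: K0rel_mulC.
Qed.

Lemma K0_mul1 : left_id (\pi_K0 K0one) K0_mul.
Proof.
by elim/quotW=> x; rewrite K0_mulE; apply: K0_eqP; exact: K0rel_mul1.
Qed.

Lemma K0_mulD : left_distributive K0_mul K0_add.
Proof.
elim/quotW=> x; elim/quotW=> y; elim/quotW=> z.
rewrite (K0_addE x y) (K0_mulE _ z) (K0_mulE x) (K0_mulE y).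
by rewrite (K0_addE (K0mul x z)); apply: K0_eqP; exact: K0rel_mulD.
Qed.

HB.instance Definition _ :=
  GRing.Zmodule_isComPzRing.Build K0 K0_mulA K0_mulC K0_mul1 K0_mulD.

Definition motivic_class (X : variety) : K0 := \pi_K0 (K0class X).

Lemma affine_space_locally_closed n : locally_closed [set: 'I_n -> C].
Proof.
exists set0, [set 1%:MP]; apply/seteqP; split=> x // _; split=> // h.
by move: (h 1%:MP erefl); rewrite mevalC => /eqP; rewrite oner_eq0.
Qed.

Definition Lefschetz : K0 :=
  motivic_class (Variety (@affine_space_locally_closed 1)).

Lemma finite_nat_bound (A : set nat) :
  finite_set A -> exists b, forall x, A x -> (x < b)%N.
Proof.
move=> /finite_fsetP[X ->]; exists (\max_(x <- X) x).+1%N => x /= xX.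
by rewrite ltnS; apply: leq_bigmax_seq.
Qed.

Lemma smulp_const a f : smulp (sconst a) f = fun n => a * f n.
Proof.
apply/funext=> n; rewrite /smulp big_ord_recl /= subn0 {1}/sconst /=.
by rewrite big1 ?addr0// => i _; rewrite /sconst /= mul0r.
Qed.

Lemma series_division (g h : series) b :
  g b != 0 -> (forall i, (i < b)%N -> g i = 0) ->
  (forall i, (i < b)%N -> h i = 0) ->
  exists q, h = smulp q g /\
    forall m, (forall i, (i < b + m)%N -> h i = 0) ->
      forall i, (i < m)%N -> q i = 0.
Proof.
move=> gb g0 h0.
pose next s := (h (b + size s)%N
   - \sum_(i < size s) s`_i * g (b + size s - i)%N) / g b.
pose qs n := iter n (fun s => rcons s (next s)) [::].
have sqs n : size (qs n) = n by elim: n => //= n IH; rewrite size_rcons IH.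
pose q n := (qs n.+1)`_n.
have qsE n i : (i < n)%N -> (qs n)`_i = q i.
  elim: n => // n IH; rewrite ltnS leq_eqVlt => /orP[/eqP->//|lt_in].
  by rewrite /= nth_rcons sqs lt_in IH.
have qE n : h (b + n)%N = \sum_(i < n.+1) q i * g (b + n - i)%N.
  rewrite big_ord_recr /= addnK {2}/q /= nth_rcons sqs ltnn eqxx /next sqs.
  rewrite divfK//.
  rewrite [X in X + _](eq_bigr (fun i : 'I_n => (qs n)`_i * g (b + n - i)%N)).
    by rewrite [RHS]addrC subrK.
  by move=> i _; rewrite qsE.
exists q; split.
  apply/funext=> n; rewrite /smulp.
  have [lt_nb|le_bn] := ltnP n b.
    rewrite h0// big1// => i _; rewrite g0 ?mulr0//.
    by rewrite (leq_ltn_trans (leq_subr _ _)).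
  rewrite -{1}(subnKC le_bn) qE subnKC//.
  rewrite -(big_mkord xpredT (fun i => q i * g (n - i)%N)).
  rewrite -[RHS](big_mkord xpredT (fun i => q i * g (n - i)%N)).
  rewrite [RHS](@big_cat_nat _ _ _ (n - b).+1)//= ?ltnS ?leq_subr//.
  rewrite [X in _ = _ + X]big_nat [X in _ = _ + X]big1 ?addr0//.
  move=> i /andP[le_i lt_i].
  have lt_n : (n < i + b)%N by rewrite -(subnK le_bn) ltn_add2r.
  by rewrite g0 ?mulr0// ltn_subLR.
move=> m hm; elim/ltn_ind=> i IH lt_im.
have := qE i; rewrite hm ?ltn_add2l// big_ord_recr /= addnK big1 ?add0r.
  by move/esym/eqP; rewrite mulf_eq0 (negPf gb) orbF => /eqP.
by move=> j _; rewrite IH ?mul0r// (ltn_trans _ lt_im).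
Qed.

Section Stratum.
Variables Gamma Delta : set nat.
Let N := (max_gap Gamma Delta).+1.

Definition free_coordinate (i j : nat) : Prop :=
  [/\ Delta i, Gamma j, ~ Delta j & (i < j)%N].

(** An ideal with order set [Delta] contains all series of the ring of order
    larger than [max_gap], and modulo these it has a unique reduced echelon
    basis [t^i + \sum_j v_(i,j) t^j], where [i] runs through the elements of
    [Delta] below [max_gap] and [j] through the elements of
    [Gamma `\` Delta] above [i].  It consists of the series in
    [echelon_ideal v]; see [stratum_bijection]. *)
Definition echelon_ideal (v : 'I_(N * N) -> C) : set series :=
  [set f | semigroup_ring Gamma f /\
     forall j : 'I_N, Gamma j -> ~ Delta j ->
       f j = \sum_(i < N) v (mxvec_index i j) * f i].

Definition stratum : set ('I_(N * N) -> C) :=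
  [set v | [/\ forall i j : 'I_N,
                 ~ free_coordinate i j -> v (mxvec_index i j) = 0,
               is_ideal Gamma (echelon_ideal v)
             & orders (echelon_ideal v) = Delta]].

Let reduced (v : 'I_(N * N) -> C) :=
  forall i j : 'I_N, ~ free_coordinate i j -> v (mxvec_index i j) = 0.

Let gap n := `[< Gamma n /\ ~ Delta n >] && (n < N)%N.

Let expoly (a : series) (n : nat) : {mpoly C[N * N]} :=
  if gap n then \sum_(i < N) 'X_(mxvec_index i (inord n)) * (a i)%:MP
  else (a n)%:MP.

Let extend (a : series) (v : 'I_(N * N) -> C) : series :=
  fun n => (expoly a n).@[v].

Lemma extendE a v n : extend a v n =
  if gap n then \sum_(i < N) v (mxvec_index i (inord n)) * a i else a n.
Proof.
rewrite /extend /expoly; case: ifP => _; last by rewrite mevalC.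
rewrite rmorph_sum /=; apply: eq_bigr => i _.
by rewrite rmorphM /= mevalC mevalXU.
Qed.

Lemma extend_in a v : semigroup_ring Gamma a -> reduced v ->
  echelon_ideal v (extend a v).
Proof.
move=> aG rv; split=> [n|j Gj Dj].
  rewrite extendE; case: ifP => [/andP[/asboolP[]//]|_]; exact: aG.
have gj : gap j by apply/andP; split=> //; apply/asboolP.
rewrite extendE gj inord_val; apply: eq_bigr => i _.
rewrite extendE; case: ifP => // /andP[/asboolP[_ Di] _].
by rewrite rv ?mul0r// => -[].
Qed.

Lemma extend_id f v : echelon_ideal v f -> extend f v = f.
Proof.
case=> _ h; apply/funext => n; rewrite extendE.
case: ifP => // /andP[/asboolP[Gn Dn] nN].
by rewrite -{2}(inordK nN) h ?inordK.
Qed.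

Let orders0 : set nat := [set n | Gamma n /\ ~~ gap n].

Lemma orders_echelon v : reduced v -> orders (echelon_ideal v) = orders0.
Proof.
move=> rv; apply/seteqP; split=> n.
  case=> f [[fG hf] fn fi]; split; first exact: fG.
  apply/negP => /andP[/asboolP[Gn Dn] nN]; move/eqP: fn; apply.
  rewrite -(inordK nN) hf ?inordK// big1// => i _.
  have [lt_in|le_ni] := ltnP i n; first by rewrite fi ?mulr0.
  by rewrite rv ?mul0r// => -[_ _ _]; rewrite inordK// ltnNge le_ni.
case=> Gn gn; exists (extend (fun m => (m == n)%:R) v); split.
- by apply: extend_in => // m; case: (eqVneq m n) => [->//|_]; rewrite eqxx.
- by rewrite extendE (negPf gn) eqxx oner_neq0.
move=> m mn; rewrite extendE; case: ifP => [/andP[_ mN]|_]; last first.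
  by rewrite ltn_eqF.
rewrite big1// => i _; case: eqP => [ein|_]; last by rewrite mulr0.
rewrite rv ?mul0r// => -[_ _ _]; rewrite inordK// ein ltnNge.
by rewrite (ltnW mn).
Qed.

Lemma stratum_locally_closed : locally_closed stratum.
Proof.
have [o0D|no0D] := pselect (orders0 = Delta); last first.
  exists [set 1%:MP], setT; apply/seteqP; split=> v //.
    by case=> rv _; rewrite orders_echelon.
  by case=> /(_ _ erefl)/eqP; rewrite mevalC oner_eq0.
pose P1 : set {mpoly C[N * N]} := [set p | exists i j : 'I_N,
  ~ free_coordinate i j /\ p = 'X_(mxvec_index i j)].
pose mulpoly (a g : series) n := \sum_(k < n.+1) (g k)%:MP * expoly a (n - k).
pose P2 : set {mpoly C[N * N]} := [set p | exists a g (j : 'I_N),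
  [/\ semigroup_ring Gamma a, semigroup_ring Gamma g, Gamma j, ~ Delta j &
   p = mulpoly a g j - \sum_(i < N) 'X_(mxvec_index i j) * mulpoly a g i]].
have mulpolyE a g n v : (mulpoly a g n).@[v] = smulp g (extend a v) n.
  rewrite rmorph_sum; apply: eq_bigr => k _.
  by rewrite rmorphM /= mevalC.
have P2E a g (j : 'I_N) v :
   (mulpoly a g j - \sum_(i < N) 'X_(mxvec_index i j) * mulpoly a g i).@[v]
   = smulp g (extend a v) j
     - \sum_(i < N) v (mxvec_index i j) * smulp g (extend a v) i.
  rewrite rmorphB /= mulpolyE rmorph_sum; congr (_ - _).
  by apply: eq_bigr => i _; rewrite rmorphM /= mevalXU mulpolyE.
pose P3 : set {mpoly C[N * N]} := [set p | exists a g n,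
  [/\ semigroup_ring Gamma a, semigroup_ring Gamma g, ~ Gamma n &
   p = mulpoly a g n]].
exists (P1 `|` P2 `|` P3), [set 1%:MP]; apply/seteqP; split=> v.
  case=> rv [_ _ _ mulI] _; split; last first.
    by move/(_ _ erefl)/eqP; rewrite mevalC oner_eq0.
  move=> p [[[i [j [nij ->]]]|[a [g [j [aG gG Gj Dj ->]]]]]|].
  - by rewrite mevalXU rv.
  - rewrite P2E; apply/eqP; rewrite subr_eq0; apply/eqP.
    by case: (mulI _ _ gG (extend_in aG rv)) => _; apply.
  move=> [a [g [n [aG gG Gn ->]]]]; rewrite mulpolyE.
  case: (mulI _ _ gG (extend_in aG rv)) => h _.
  by have [//|/h] := eqVneq (smulp g (extend a v) n) 0.
case=> hv _.
have rv : reduced v.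
  move=> i j nij; rewrite -[LHS](mevalXU v); apply: hv.
  by left; left; exists i, j.
split=> //; last by rewrite orders_echelon.
split=> [f []//| |f g [fG hf] [gG hg]|g f gG If].
- split=> [n|j Gj Dj]; first by rewrite /sconst; case: ifP; rewrite eqxx.
  by rewrite /sconst if_same big1// => i _; rewrite if_same mulr0.
- split=> [n|j Gj Dj].
    rewrite /saddp; have [->|/fG//] := eqVneq (f n) 0.
    by rewrite add0r; apply: gG.
  rewrite /saddp hf// hg// -big_split; apply: eq_bigr => i _ /=.
  by rewrite mulrDr.
have [fG _] := If; split=> [n|j Gj Dj]; last first.
  rewrite -(extend_id If); apply/eqP; rewrite -subr_eq0 -P2E; apply/eqP/hv.
  by left; right; exists f, g, j.
apply: contraPP => Gn; rewrite -(extend_id If) -mulpolyE; apply/negP/negPn/eqP.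
by apply: hv; right; exists f, g, n.
Qed.

Hypothesis GammaP : numerical_semigroup Gamma.
Hypothesis DeltaG : Delta `<=` Gamma.
Hypothesis finD : finite_set (Gamma `\` Delta).

Lemma lt_max_gap n : Gamma n -> ~ Delta n -> (n < N)%N.
Proof.
move=> Gn Dn; have [b hb] := finite_nat_bound finD.
have [m [hm mb]] : exists m, (Gamma `\` Delta) m /\
    forall x, (Gamma `\` Delta) x -> (x <= m)%N.
  have ex : exists m, `[< (Gamma `\` Delta) m >] by exists n; apply/asboolP.
  have bd m : `[< (Gamma `\` Delta) m >] -> (m <= b)%N.
    by move=> /asboolP/hb/ltnW.
  exists (ex_maxn ex bd); case: ex_maxnP => m /asboolP hm hmax.
  by split=> // x hx; apply: hmax; apply/asboolP.
rewrite /N ltnS /max_gap; case: xgetP => [g _ [_ /(_ n)]|/(_ m)[]//].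
by apply.
Qed.

Section Ideal.
Variable I : set series.
Hypothesis Iideal : is_ideal Gamma I.
Hypothesis Iorders : orders I = Delta.

Let IG f : I f -> semigroup_ring Gamma f.
Proof. by case: Iideal => h _ _ _; exact: h. Qed.

Let I_comb a f g : I f -> I g -> I (fun n => f n + a * g n).
Proof.
case: Iideal => _ _ ID IM If Ig; apply: ID => //.
have -> : (fun n => a * g n) = smulp (sconst a) g by rewrite smulp_const.
apply: IM => // -[_|n]; first by case: GammaP.
by rewrite /sconst /= eqxx.
Qed.

Let I_sum (r : seq 'I_N) (a : 'I_N -> C) (b : 'I_N -> series) f :
  I f -> (forall i, i \in r -> I (b i)) ->
  I (fun n => f n + \sum_(i <- r) a i * b i n).
Proof.
elim: r f => [|i r IH] f If Ib.
  by under eq_fun do rewrite big_nil addr0.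
under eq_fun do rewrite big_cons addrA.
apply: (IH (fun n => f n + a i * b i n)) => [|j jr].
  by apply: I_comb => //; apply: Ib; rewrite mem_head.
by apply: Ib; rewrite in_cons jr orbT.
Qed.

Let I_order n : Delta n ->
  exists f, [/\ I f, f n = 1 & forall i, (i < n)%N -> f i = 0].
Proof.
rewrite -Iorders => -[f [If fn f0]].
exists (fun m => 0 + (f n)^-1 * f m); split.
- by apply: (@I_comb _ (fun=> 0)) => //; case: Iideal => _ + _ _;
    rewrite /sconst; under eq_fun do rewrite if_same.
- by rewrite add0r mulVf.
- by move=> i /f0 ->; rewrite add0r mulr0.
Qed.

Let I_leading f n : I f -> f n != 0 ->
  exists m, [/\ (m <= n)%N, Delta m & f m != 0].
Proof.
move=> If fn; have ex : exists m, f m != 0 by exists n.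
case: (ex_minnP ex) => m fm hm; exists m; split=> //; first exact: hm.
rewrite -Iorders; exists f; split=> // i lt_im; apply/eqP.
by apply: contraTT lt_im => /hm; rewrite -leqNgt.
Qed.

Let I_conductor : exists B, forall f : series,
  (forall i, (i < B)%N -> f i = 0) -> I f.
Proof.
have [c hc] := finite_nat_bound (let: And3 _ _ h := GammaP in h).
have cG n : (c <= n)%N -> Gamma n.
  by move=> cn; apply: contrapT => /hc; rewrite ltnNge cn.
have [d Dd] : exists d, Delta d.
  exists (maxn c N); apply: contrapT => nD.
  have := lt_max_gap (cG _ (leq_maxl c N)) nD.
  by rewrite ltnNge leq_maxr.
have [g [Ig gd g0]] := I_order Dd.
exists (d + c)%N => f f0.
have [||q [fE q0]] := @series_division g f d _ g0.
- by rewrite gd oner_neq0.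
- by move=> i id; apply: f0; rewrite ltn_addr.
rewrite fE; case: Iideal => _ _ _; apply=> // n.
have [/(q0 _ f0)->|/cG//] := ltnP n c; by rewrite eqxx.
Qed.

Let I_tail f : semigroup_ring Gamma f ->
  (forall i, (i < N)%N -> f i = 0) -> I f.
Proof.
have [B hB] := I_conductor.
have [le_BN|lt_NB] := leqP B N.
  by move=> _ f0; apply: hB => i iB; apply: f0; rewrite (leq_trans iB).
suff h k : (k <= B - N)%N -> forall f, semigroup_ring Gamma f ->
    (forall i, (i < B - k)%N -> f i = 0) -> I f.
  by move=> fG f0; apply: (h (B - N)%N) => //; rewrite subKn ?(ltnW lt_NB).
elim: k => [_ g _|k IH lt_k g gG g0]; first by rewrite subn0; exact: hB.
have kB : (k < B)%N by rewrite (leq_trans lt_k) ?leq_subr.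
set m := (B - k.+1)%N; have Sm : (B - k)%N = m.+1 by rewrite /m -subnSK.
have [gm|gm] := eqVneq (g m) 0.
  apply: IH; rewrite ?(ltnW lt_k)// => i.
  rewrite Sm ltnS leq_eqVlt => /orP[/eqP->//|]; exact: g0.
have Dm : Delta m.
  apply: contrapT => Dm; have := lt_max_gap (gG _ gm) Dm.
  by rewrite ltnNge leq_subRL ?(ltnW lt_NB)// addnC -leq_subRL ?lt_k// ltnW.
have [b [Ib bm b0]] := I_order Dm.
have -> : g = fun n => (g n + (- g m) * b n) + g m * b n.
  by apply/funext=> n; rewrite mulNr subrK.
apply: I_comb => //; apply: IH; first exact: ltnW.
  move=> n; have [gn|/gG//] := eqVneq (g n) 0.
  by rewrite gn add0r; have [->|/(IG Ib)//] := eqVneq (b n) 0; rewrite mulr0 eqxx.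
move=> i; rewrite Sm ltnS leq_eqVlt => /orP[/eqP->|im].
  by rewrite bm mulr1 subrr.
by rewrite g0// b0// mulr0 addr0.
Qed.

Let I_reduced d : Delta d -> exists b, [/\ I b, b d = 1,
  forall i, (i < d)%N -> b i = 0 &
  forall i, Delta i -> (d < i < N)%N -> b i = 0].
Proof.
move=> Dd; suff h k : exists b, [/\ I b, b d = 1,
    forall i, (i < d)%N -> b i = 0 &
    forall i, Delta i -> (d < i < k)%N -> b i = 0] by exact: h.
elim: k => [|k [b [Ib bd b0 b1]]].
  by have [b [? ? ?]] := I_order Dd; exists b; split=> // i _; rewrite andbF.
have [[Dk lt_dk]|nk] := pselect (Delta k /\ (d < k)%N); last first.
  exists b; split=> // i Di /andP[di]; rewrite ltnS leq_eqVlt.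
  case/orP => [/eqP ik|ik]; last by apply: b1; rewrite ?di.
  by case: nk; rewrite -ik.
have [e [Ie ek e0]] := I_order Dk.
exists (fun n => b n + (- b k) * e n); split.
- exact: I_comb.
- by rewrite bd e0// mulr0 addr0.
- by move=> i id; rewrite b0// e0 ?mulr0 ?addr0// (ltn_trans id).
move=> i Di /andP[di]; rewrite ltnS leq_eqVlt => /orP[/eqP->|ik].
  by rewrite ek mulr1 subrr.
by rewrite b1 ?di// e0// mulr0 addr0.
Qed.

Lemma ideal_echelon : exists2 v, stratum v & I = echelon_ideal v.
Proof.
have /choice[b hb] (i : 'I_N) : exists b : series, Delta i ->
    [/\ I b, b i = 1, forall j, (j < i)%N -> b j = 0 &
       forall j, Delta j -> (i < j < N)%N -> b j = 0].
  by have [/I_reduced[b hb]|nD] := pselect (Delta i); [exists b|exists (fun=> 0)].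
pose v (k : 'I_(N * N)) : C :=
  let: (i, j) := enum_val (cast_ord (esym (mxvec_cast N N)) k) in
  if `[< free_coordinate i j >] then b i j else 0.
have vE (i j : 'I_N) : v (mxvec_index i j) =
    if `[< free_coordinate i j >] then b i j else 0.
  by rewrite /v /mxvec_index cast_ordK enum_rankK.
have rv : reduced v by move=> i j nij; rewrite vE asboolF.
pose r := [seq i <- enum 'I_N | `[< Delta (i : 'I_N) >]].
have sumE f (j : 'I_N) :
   f j + \sum_(i <- r) (- f i) * b i j =
   if `[< Delta j >] then 0 else f j - \sum_(i < N) v (mxvec_index i j) * f i.
  rewrite big_filter big_enum_cond /=; case: asboolP => Dj.
    rewrite (bigD1 j) ?asboolT//= big1 => [|i /andP[/asboolP Di]].
      by have [_ -> _ _] := hb j Dj; rewrite mulr1 addr0 subrr.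
    rewrite -val_eqE neq_ltn; have [_ _ b0 b1] := hb i Di.
    by case/orP => ij; [rewrite b1 ?mulr0 ?ij ?ltn_ord|rewrite b0 ?mulr0].
  congr (_ + _); rewrite -sumrN [RHS](bigID (fun i : 'I_N => `[< Delta i >])) /=.
  rewrite [X in _ = _ + X]big1 ?addr0 => [|i /asboolPn nDi]; last first.
    by rewrite rv ?mul0r ?oppr0// => -[].
  apply: eq_bigr => i /asboolP Di; rewrite vE mulNr mulrC.
  case: asboolP => // nf; congr (- (_ * _)).
  have [Ib bi b0 _] := hb i Di; have [lt_ij|le_ji] := ltnP i j.
    by have [//|/(IG Ib) Gj] := eqVneq (b i j) 0; case: nf.
  apply: b0; rewrite ltn_neqAle le_ji andbT; apply/eqP => ji.
  by case: Dj; rewrite ji.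
have IsumP f : I f -> I (fun n => f n + \sum_(i <- r) (- f i) * b i n).
  move=> If; apply: (@I_sum r (fun i => - f i)) => // i.
  by rewrite mem_filter => /andP[/asboolP/hb[]].
have Iv : I = echelon_ideal v.
  apply/seteqP; split=> f.
    move=> If; split=> [|j Gj Dj]; first exact: IG.
    have If' := IsumP _ If.
    apply/eqP; rewrite -subr_eq0; apply/negPn/negP.
    have := sumE f j; rewrite asboolF// => <- hj.
    have [m [le_mj Dm]] := I_leading If' hj.
    have lt_mN := leq_ltn_trans le_mj (ltn_ord j).
    by have := sumE f (Ordinal lt_mN); rewrite asboolT//= => ->; rewrite eqxx.
  case=> fG hf.
  have Ih : I (fun n => f n + \sum_(i <- r) (- f i) * b i n).
    apply: I_tail => [n|n lt_nN].
      apply: contraPP => Gn; have [->|/fG//] := eqVneq (f n) 0.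
      rewrite add0r big_seq big1 ?eqxx// => i.
      rewrite mem_filter => /andP[/asboolP/hb[Ib _ _ _] _].
      by have [->|/(IG Ib)//] := eqVneq (b i n) 0; rewrite mulr0.
    have -> := sumE f (Ordinal lt_nN); case: asboolP => //= Dn.
    have [Gn|Gn] := pselect (Gamma n).
      by apply/eqP; rewrite subr_eq0; apply/eqP; apply: (hf (Ordinal lt_nN)).
    have [->|/fG//] := eqVneq (f n) 0; rewrite sub0r big1 ?oppr0// => i _.
    by rewrite rv ?mul0r// => -[].
  have -> : f = fun n => (f n + \sum_(i <- r) (- f i) * b i n)
                         + \sum_(i <- r) f i * b i n.
    apply/funext=> n; rewrite -addrA -big_split big1 ?addr0// => i _ /=.
    by rewrite mulNr addNr.
  apply: (@I_sum r (fun i => f i)) => // i.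
  by rewrite mem_filter => /andP[/asboolP/hb[]].
by exists v => //; split; rewrite -?Iv.
Qed.
End Ideal.

Lemma stratum_bijection I : is_ideal Gamma I -> orders I = Delta ->
  exists! v, stratum v /\ I = echelon_ideal v.
Proof.
move=> idI oI; have [v sv Iv] := ideal_echelon idI oI.
exists v; split=> // w [[rw _ _] Iw]; have [rv _ _] := sv.
apply/funext => k; case/mxvec_indexP: k => i j.
have [fij|nf] := pselect (free_coordinate i j); last by rewrite rv ?rw.
have [Di Gj Dj lt_ij] := fij.
pose e : series := fun n => (n == i)%:R.
have eG : semigroup_ring Gamma e.
  by rewrite /e => n; case: (eqVneq n i) => [-> _|]; [exact: DeltaG|rewrite eqxx].
have dual u : \sum_(k < N) u (mxvec_index k j) * e k = u (mxvec_index i j).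
  rewrite (bigD1 i)//= /e eqxx mulr1 big1 ?addr0// => k.
  by rewrite -val_eqE => /negPf ->; rewrite mulr0.
have := extend_in eG rv; rewrite -Iv Iw => -[_ /(_ j Gj Dj)].
have gj : gap j by apply/andP; split=> //; apply/asboolP.
rewrite extendE gj inord_val dual => ->.
rewrite -[RHS](dual w); apply: eq_bigr => k _; rewrite extendE.
case: ifP => // /andP[/asboolP[_ Dk] _].
by rewrite rw ?mul0r// => -[].
Qed.


End Stratum.

Definition stratum_class (Gamma Delta : set nat) : K0 :=
  motivic_class (Variety (stratum_locally_closed Gamma Delta)).

(** Coefficients of [q^0, ..., q^c]; [K0] is not known to be a nonzero ring
    here, so [{poly K0}] is not available. *)
Definition zeta_series (Gamma : set nat) (c : nat) : seq K0 :=
  mkseq (fun l => if l == 0%N then 1 else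
    \sum_(Delta <- fset_set (semimodules Gamma l)) stratum_class Gamma Delta)
  c.+1.

(** [test_cost n] is the cost of a membership test in [Gamma] truncated at
    [n].  [insert_cost] is charged for every item stored in a collection. *)
Record cost_model := CostModel {
  test_cost : nat -> nat;
  delete_cost : nat;
  insert_cost : nat;
  lookup_cost : nat;
  arith_cost : nat;
  test_cost_linear : exists k, forall n, (test_cost n <= k * n)%N }.

(** A computation is its value together with its cost. *)
Definition comp (A : Type) : Type := (A * nat)%type.

Definition value A (x : comp A) : A := x.1.
Definition cost A (x : comp A) : nat := x.2.

Definition ret A (a : A) : comp A := (a, 0%N).

Definition charge A (k : nat) (a : A) : comp A := (a, k).

Definition bind A B (x : comp A) (f : A -> comp B) : comp B :=
  (value (f (value x)), (cost x + cost (f (value x)))%N).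

Notation "'let!' x ':=' e1 'in' e2" := (bind e1 (fun x => e2))
  (at level 200, x name, e1 at level 100, e2 at level 200,
   format "'[v' 'let!'  x  ':='  e1  'in' '/' e2 ']'").

Fixpoint foldM S A (f : S -> A -> comp S) (s : S) (l : seq A) : comp S :=
  if l is a :: l' then let! s' := f s a in foldM f s' l' else ret s.

Fixpoint filterM A (p : A -> comp bool) (l : seq A) : comp (seq A) :=
  if l is a :: l' then
    let! b := p a in
    let! r := filterM p l' in
    ret (if b then a :: r else r)
  else ret [::].

Section Algorithm.
Variables (M : cost_model) (Gamma : set nat) (c n : nat).

Definition truncation (A : set nat) : seq nat :=
  [seq x <- iota 0 n.+1 | `[< A x >]].

Let G := truncation Gamma.

(** Is [a - x] (an integer) in [Gamma]? *)
Definition difference_test (a x : nat) : comp bool :=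
  let! d := charge (arith_cost M) (a - x)%N in
  charge (test_cost M n) ((x <= a)%N && (d \in G)).

Fixpoint some_difference (a : nat) (T : seq nat) : comp bool :=
  if T is x :: T' then
    let! b := difference_test a x in
    if b then ret true else some_difference a T'
  else ret false.

Definition add_generator (T : seq nat) (a : nat) : comp (seq nat) :=
  let! b := some_difference a T in
  if b then ret T else charge (insert_cost M) (rcons T a).

Definition generators (s : seq nat) : comp (seq nat) :=
  if s is a :: s' then
    let! T := charge (insert_cost M) [:: a] in foldM add_generator T s'
  else ret [::].

(** Do [k] more tests succeed? *)
Fixpoint differences (k : nat) (a : nat) (T : seq nat) : comp bool :=
  if k is k'.+1 then
    if T is x :: T' then
      let! b := difference_test a x in
      differences (if b then k' else k) a T'
    else ret false
  else ret true.

Definition syzygies (s T : seq nat) : comp (seq nat) :=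
  filterM (fun a =>
    let! b := differences 2 a T in
    if b then charge (insert_cost M) true else ret false) s.

Definition delete_element (x : nat) (s : seq nat) : comp (seq nat) :=
  charge (delete_cost M) (rem x s).

Definition insert_semimodule (D : seq (seq nat)) (s : seq nat) :
    comp (seq (seq nat)) :=
  charge (insert_cost M) (if s \in D then D else rcons D s).

Definition insert_children (D' : seq (seq nat)) (s : seq nat) :
    comp (seq (seq nat)) :=
  let! T := generators s in
  foldM (fun D'' x =>
    let! s' := delete_element x s in insert_semimodule D'' s') D' T.

Definition next_level (D : seq (seq nat)) : comp (seq (seq nat)) :=
  foldM insert_children [::] D.

(** [D] followed by the [k] next levels. *)
Fixpoint levels_from (k : nat) (D : seq (seq nat)) :
    comp (seq (seq (seq nat))) :=
  if k is k'.+1 then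
    let! D' := next_level D in
    let! r := levels_from k' D' in
    ret (D :: r)
  else ret [:: D].

(** The collections of index [1, ..., c]. *)
Definition tree : comp (seq (seq (seq nat))) :=
  let! s := delete_element 0%N G in
  let! D := insert_semimodule [::] s in
  levels_from c.-1 D.

(** The last element of the increasing list [s] that is not in its increasing
    sublist [d], by a parallel scan; [g] is the current candidate. *)
Fixpoint scan_max_gap (s d : seq nat) (g : nat) : comp nat :=
  if s is x :: s' then
    let! b := charge (arith_cost M) (x == head x.+1 d) in
    if b then scan_max_gap s' (behead d) g else scan_max_gap s' d x
  else ret g.

Fixpoint count_below (g : nat) (T : seq nat) (k : nat) : comp nat :=
  if T is x :: T' then
    let! b := charge (arith_cost M) (x < g)%N in
    if b then
      let! k' := charge (arith_cost M) k.+1 in count_below g T' k'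
    else count_below g T' k
  else ret k.

Definition table := seq (seq nat * K0).

Definition lookup (t : table) (s : seq nat) : comp K0 :=
  charge (lookup_cost M) (foldr (fun e r => if e.1 == s then e.2 else r) 0 t).

Definition insert_gap (g : nat) (s : seq nat) : comp (seq nat) :=
  charge (insert_cost M) [seq x <- G | (x == g) || (x \in s)].

(** The exponent is a truncated difference: [Lefschetz] is not invertible
    in [K0], and a negative exponent does not occur in a correct run. *)
Definition compute_class (t : table) (s : seq nat) : comp table :=
  let! g := scan_max_gap G s 0%N in
  let! T := generators s in
  let! Z := syzygies s T in
  let! TZ := generators Z in
  let! C1 := count_below g T 0%N in
  let! C2 := count_below g TZ 0%N in
  let! m := insert_gap g s in
  let! x := lookup t m in
  let! e := charge (arith_cost M) (C1 - C2)%N in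
  let! y := charge (arith_cost M) (Lefschetz ^+ e) in
  let! z := charge (arith_cost M) (x * y) in
  charge (insert_cost M) (rcons t (s, z)).

Definition all_classes (levels : seq (seq (seq nat))) : comp table :=
  let! t := charge (insert_cost M) [:: (G, 1)] in
  foldM (foldM compute_class) t levels.

Definition level_sum (t : table) (D : seq (seq nat)) : comp K0 :=
  foldM (fun acc s =>
    let! x := lookup t s in charge (arith_cost M) (acc + x)) 0 D.

Definition sum_levels (t : table) (levels : seq (seq (seq nat))) :
    comp (seq K0) :=
  foldM (fun r D =>
    let! x := level_sum t D in charge (arith_cost M) (rcons r x)) [:: 1] levels.

Definition zeta_algorithm : comp (seq K0) :=
  let! levels := tree in
  let! t := all_classes levels in
  sum_levels t levels.

Definition suffices : Prop :=
  (forall l Delta, (1 <= l <= c)%N -> semimodules Gamma l Delta ->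
     Gamma `\` Delta `<=` [set x | (x <= n)%N]) /\
  value zeta_algorithm = zeta_series Gamma c.

End Algorithm.

(* Main.v *)
Require Import Defs.
From mathcomp Require Import all_boot boolp classical_sets.
From mathcomp Require Import finmap cardinality zify.

Set Implicit Arguments.
Unset Strict Implicit.
Unset Printing Implicit Defensive.

(** The estimate follows from bounding the work done on one semimodule.

    Write [m] for the least positive element [alpha_1] of [Gamma].  The list
    of generators that subroutine (a) builds never contains two numbers
    congruent modulo [m]: if [x < a] are congruent, then [a - x] is a multiple
    of [m], so the test of [a] against [x] succeeds and [a] is not added.
    Hence every generating set that occurs, also of the syzygies, has at most
    [m] elements, and running once through it with membership tests costs
    [O(m * n)] ([test_row]).  Subroutines (a) and (b) make one such run for
    each stored element of the semimodule, and a semimodule [Delta] with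
    [#(Gamma \ Delta) = l] is stored as [#(Gamma cap [0, n]) - l] numbers,
    which is at most [n - l] because [1] is not in [Gamma].  So the tree step
    and the class step both cost [O(n * m * (n - l))] per list of level [l]
    ([insert_children_spec], [compute_class_cost]).

    The number of lists of level [l] is at most [chi_l]: the computed
    generators of [Delta] are its true minimal generators below [n], so
    removing one of them gives again a semimodule ([generator_removal]), and
    the collections contain no list twice.  Counting [chi_l] needs that there
    are finitely many semimodules of colength [l], which holds as all their
    gaps lie in [[0, n]].

    The costs that are not proportional to the number of semimodules,
    a constant and one addition for each of the [c] levels, are absorbed by
    the factor [c] of the term [l = 1].  For this the factors [n - l] must be
    positive.  The semimodule [c + Gamma] has colength [c]
    ([semimodule_conductor]) and the gap [c + (c - 1)], so a sufficient
    truncation has [n >= 2 c - 1 > c >= l]. *)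

(** * Values and costs of monadic computations *)

#[local] Arguments value : simpl never.
#[local] Arguments cost : simpl never.
#[local] Arguments bind : simpl never.

Lemma cost_bind A B (x : Defs.comp A) (f : A -> Defs.comp B) :
  cost (bind x f) = cost x + cost (f (value x)).
Proof. by []. Qed.

Lemma value_bind A B (x : Defs.comp A) (f : A -> Defs.comp B) :
  value (bind x f) = value (f (value x)).
Proof. by []. Qed.

Lemma cost_charge A d (a : A) : cost (charge d a) = d.
Proof. by []. Qed.

Lemma value_charge A d (a : A) : value (charge d a) = a.
Proof. by []. Qed.

Lemma cost_ret A (a : A) : cost (ret a) = 0.
Proof. by []. Qed.

Lemma value_ret A (a : A) : value (ret a) = a.
Proof. by []. Qed.

Definition costE := (cost_bind, cost_charge, cost_ret).
Definition valueE := (value_bind, value_charge, value_ret).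

(** The invariant [I] may depend on the prefix of the list that has been
    consumed: it is what relates a partial list of generators to the part of
    the semimodule scanned so far. *)
Lemma foldM_invariant S A (f : S -> A -> Defs.comp S) (I : seq A -> S -> Prop)
    (B : A -> nat) (l : seq A) (s0 : S) :
  I [::] s0 ->
  (forall p a r s, l = p ++ a :: r -> I p s ->
     I (rcons p a) (value (f s a)) /\ cost (f s a) <= B a) ->
  I l (value (foldM f s0 l)) /\ cost (foldM f s0 l) <= \sum_(a <- l) B a.
Proof.
move=> I0 step; suff h r p s : l = p ++ r -> I p s ->
    I l (value (foldM f s r)) /\ cost (foldM f s r) <= \sum_(a <- r) B a.
  exact: h I0.
elim: r p s => [|a r IH] p s lE Ip.
  by rewrite cats0 in lE; rewrite lE big_nil.
have [Ia Ba] := step _ _ _ _ lE Ip.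
have [|Il Br] := IH (rcons p a) _ _ Ia; first by rewrite cat_rcons.
by split=> //; rewrite big_cons cost_bind leq_add.
Qed.

Lemma foldM_cost S (A : eqType) (f : S -> A -> Defs.comp S) (B : A -> nat)
    (l : seq A) s0 :
  (forall s a, a \in l -> cost (f s a) <= B a) ->
  cost (foldM f s0 l) <= \sum_(a <- l) B a.
Proof.
move=> h.
have [|p a r s lE _|//] := @foldM_invariant _ _ f (fun _ _ => True) B l s0.
  by [].
by split=> //; apply: h; rewrite lE mem_cat mem_head orbT.
Qed.

Lemma filterM_spec (A : eqType) (p : A -> Defs.comp bool) (B : nat)
    (l : seq A) :
  (forall a, cost (p a) <= B) ->
  value (filterM p l) = [seq a <- l | value (p a)] /\
  cost (filterM p l) <= size l * B.
Proof.
move=> pB; elim: l => [//|a l [IHv IHc]] /=.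
rewrite !valueE IHv !costE mulSn addn0.
by split=> //; apply: leq_add.
Qed.

(** * Truncations and the cost of one run through a generating set *)

Section Semigroup.
Variable Gamma : set nat.
Hypothesis Gamma0 : Gamma 0.
Hypothesis GammaD : forall x y, Gamma x -> Gamma y -> Gamma (x + y).

Lemma semigroup_muln k x : Gamma x -> Gamma (k * x).
Proof.
by move=> Gx; elim: k => [|k IH]; rewrite ?mul0n// mulSn; apply: GammaD.
Qed.

Lemma mem_truncation n (X : set nat) x :
  (x \in truncation n X) = (x <= n) && `[< X x >].
Proof. by rewrite mem_filter mem_iota add0n ltnS andbC. Qed.

Lemma truncation_sorted n (X : set nat) : sorted ltn (truncation n X).
Proof. exact/(sorted_filter ltn_trans)/iota_ltn_sorted. Qed.

Lemma truncation_setD1 n (X : set nat) x :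
  rem x (truncation n X) = truncation n (X `\ x)%classic.
Proof.
rewrite rem_filter ?filter_uniq ?iota_uniq// -filter_predI.
apply: eq_filter => y /=; apply/andP/asboolP => [[yx /asboolP Xy]|[Xy yx]].
  by split=> //; apply/eqP.
by split; [apply/eqP|apply/asboolP].
Qed.

Definition minimal_part (P T : seq nat) : Prop :=
  [/\ {subset T <= P},
      forall x y, x \in T -> y \in P -> y < x -> ~ Gamma (x - y) &
      forall y, y \in P -> exists2 t, t \in T & t <= y /\ Gamma (y - t)].

(** The property of generating sets that bounds their size by [m]. *)
Definition incongruent (m : nat) (T : seq nat) : bool :=
  uniq [seq x %% m | x <- T].

Lemma incongruent_size m T : 0 < m -> incongruent m T -> size T <= m.
Proof.
move=> m0 uT; rewrite -(size_map (modn^~ m)) -[leqRHS](size_iota 0).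
by apply: uniq_leq_size => // _ /mapP[x _ ->]; rewrite mem_iota ltn_pmod.
Qed.

Variables (M : cost_model) (k : nat).
Hypothesis test_le : forall n, test_cost M n <= k * n.
Variables (m n : nat).
Hypothesis m_gt0 : 0 < m.
Hypothesis Gamma_m : Gamma m.
Hypothesis n_gt0 : 0 < n.

(** Majorizes each elementary operation, and [k] majorizes the slope of the
    cost of a membership test. *)
Definition unit_cost :=
  arith_cost M + delete_cost M + insert_cost M + lookup_cost M + k.
Let u := unit_cost.

(** The unit in which all later costs are measured: it bounds testing one
    number against a whole generating set. *)
Definition row_cost := u * m * n.

Lemma test_row (T : seq nat) : size T <= m ->
  size T * (arith_cost M + test_cost M n) + insert_cost M <= row_cost.
Proof.
move=> Tm; have tn := test_le n.
have h : arith_cost M + test_cost M n + insert_cost M <= u * n.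
  rewrite /u /unit_cost; nia.
apply: (@leq_trans (m * (u * n))); last by rewrite /row_cost; nia.
apply: (@leq_trans (m * (arith_cost M + test_cost M n + insert_cost M))).
  nia.
by rewrite leq_mul2l h orbT.
Qed.

Lemma units_row j d : j <= m -> d <= u -> j * d <= row_cost.
Proof.
move=> jm du; apply: (@leq_trans (m * u)); first exact: leq_mul.
by rewrite /row_cost mulnC leq_pmulr.
Qed.

(** Truncating [Gamma] at [n] does not change the outcome, since the tested
    difference is at most [n]. *)
Lemma difference_testE a x : a <= n ->
  value (difference_test M Gamma n a x) = (x <= a) && `[< Gamma (a - x) >].
Proof.
move=> an; rewrite /difference_test !valueE.
by rewrite mem_truncation (leq_trans (leq_subr _ _) an).
Qed.

Lemma some_difference_spec a T :
  value (some_difference M Gamma n a T) =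
    has (fun x => value (difference_test M Gamma n a x)) T /\
  cost (some_difference M Gamma n a T) <=
    size T * (arith_cost M + test_cost M n).
Proof.
elim: T => [//|x T [IHv IHc]] /=.
rewrite value_bind cost_bind mulSn leq_add2l.
by case: (value (difference_test _ _ _ a x)); rewrite ?IHv.
Qed.

Lemma differences_cost j a T :
  cost (differences M Gamma n j a T) <=
    size T * (arith_cost M + test_cost M n).
Proof.
elim: T j => [|x T IH] [|j] //.
by rewrite [differences _ _ _ _ _ _]/= cost_bind mulSn leq_add2l; case: ifP.
Qed.

(** * Minimal generators and syzygies *)

Definition generator_invariant (P T : seq nat) :=
  minimal_part P T /\ incongruent m T.

(** Since the numbers arrive in increasing order, [a] is tested against
    every generator found so far.  If no test succeeds, then [a] is not
    reached from any earlier element [y] either: [y] is itself reached from a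
    generator [t], and [a - t = (a - y) + (y - t)].  It is also incongruent to
    all earlier generators, as multiples of [m] lie in [Gamma]. *)
Lemma add_generator_spec P T a :
  (forall y, y \in P -> y < a) -> a <= n -> generator_invariant P T ->
  generator_invariant (rcons P a) (value (add_generator M Gamma n T a)) /\
  cost (add_generator M Gamma n T a) <= row_cost.
Proof.
move=> Pa an [[TP minT genT] uT].
have [hv hc] := some_difference_spec a T.
have Tm := incongruent_size m_gt0 uT.
rewrite /add_generator value_bind cost_bind hv; split; last first.
  apply: leq_trans (test_row Tm); apply: leq_add => //.
  by case: ifP.
case: hasP => [[x xT]|nT] /=.
  rewrite difference_testE// => /andP[xa /asboolP Gax]; split=> //; split.
  - by move=> z /TP zP; rewrite mem_rcons inE zP orbT.
  - move=> z y zT; rewrite mem_rcons inE => /predU1P[->|yP]; last exact: minT.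
    by rewrite ltnNge ltnW// Pa ?TP.
  - move=> y; rewrite mem_rcons inE => /predU1P[->|/genT//].
    by exists x.
have noT x : x \in T -> ~ Gamma (a - x).
  move=> xT Gax; apply: nT; exists x; rewrite // difference_testE//.
  by rewrite ltnW ?Pa ?TP//; apply/asboolP.
split; first split.
- move=> z; rewrite !mem_rcons !inE => /predU1P[->|/TP ->]; rewrite ?eqxx//.
  by rewrite orbT.
- move=> z y; rewrite !mem_rcons !inE => /predU1P[->|zT] /predU1P[->|yP].
  + by rewrite ltnn.
  + move=> ya Gay; have [t tT [ty Gyt]] := genT y yP.
    apply: (noT t tT); have -> : a - t = (a - y) + (y - t) by lia.
    exact: GammaD.
  + by rewrite ltnNge ltnW// Pa ?TP.
  + exact: minT.
- move=> y; rewrite mem_rcons inE => /predU1P[->|/genT[t tT ?]].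
    by exists a; rewrite ?mem_rcons ?mem_head// subnn.
  by exists t => //; rewrite mem_rcons inE tT orbT.
rewrite /incongruent map_rcons rcons_uniq [X in _ && X]uT andbT.
apply/mapP => -[x xT /eqP xa]; apply: (noT x xT).
have xa' : x <= a by rewrite ltnW ?Pa ?TP.
have : m %| a - x by rewrite -eqn_mod_dvd.
by case/dvdnP => q ->; apply: semigroup_muln.
Qed.

Lemma generators_spec s : sorted ltn s -> {in s, forall x, x <= n} ->
  generator_invariant s (value (generators M Gamma n s)) /\
  cost (generators M Gamma n s) <= size s * row_cost.
Proof.
case: s => [|a s] ss sn; first by split.
have := @foldM_invariant _ _ (add_generator M Gamma n)
  (fun p T => generator_invariant (a :: p) T) (fun=> row_cost) s [:: a].
case.
- split=> //; split=> // [x y|y]; rewrite !inE => /eqP->.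
    by move=> /eqP->; rewrite ltnn.
  by exists a; rewrite ?inE// subnn.
- move=> p x r T sE inv; apply: (@add_generator_spec (a :: p)) => // [y|].
    move: ss; rewrite sE -cat_cons (sorted_pairwise ltn_trans) pairwise_cat.
    by case/and3P => /allrelP h _ _ yp; apply: h; rewrite ?mem_head.
  by apply: sn; rewrite sE inE mem_cat mem_head !orbT.
move=> inv c; rewrite /generators value_bind cost_bind; split=> //.
rewrite big_const_seq count_predT iter_addn_0 mulnC in c.
rewrite mulSn leq_add//.
by apply: leq_trans (leq_addl _ _) (test_row (T := [::]) _).
Qed.


Lemma syzygies_spec s T : size T <= m ->
  subseq (value (syzygies M Gamma n s T)) s /\
  cost (syzygies M Gamma n s T) <= size s * row_cost.
Proof.
move=> Tm; have [|-> c] := @filterM_spec _ (fun a =>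
    let! b := differences M Gamma n 2 a T in
    if b then charge (insert_cost M) true else ret false) row_cost s.
  move=> a; rewrite cost_bind; apply: leq_trans (test_row Tm).
  by apply: leq_add; [exact: differences_cost|case: ifP].
by split=> //; exact: filter_subseq.
Qed.

Lemma count_below_cost g T j :
  cost (count_below M g T j) <= size T * (arith_cost M + arith_cost M).
Proof.
elim: T j => [|x T IH] j //=.
rewrite !costE mulSn value_charge -addnA leq_add2l.
case: ifP => _; last by apply: leq_trans (IH _) _; exact: leq_addl.
by rewrite !costE leq_add2l.
Qed.

Lemma scan_max_gap_cost s d g :
  cost (scan_max_gap M s d g) <= size s * arith_cost M.
Proof.
elim: s d g => [|x s IH] d g //=.
by rewrite !costE value_charge mulSn leq_add2l; case: ifP.
Qed.

Lemma generators_size s : sorted ltn s -> {in s, forall x, x <= n} ->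
  size (value (generators M Gamma n s)) <= m.
Proof.
by move=> ss sn; have [[_ /(incongruent_size m_gt0)]] := generators_spec ss sn.
Qed.

(** * The work done on one semimodule *)

(** The two generator computations and the syzygy computation take at most
    [size s] rows each, the parallel scan one row, the two counts two rows
    each, and the remaining elementary operations three rows.  The syzygies
    form a sublist of the increasing list [s], so the bounds for generators
    apply to them. *)
Lemma compute_class_cost t X (s := truncation n X) :
  size (truncation n Gamma) <= n ->
  cost (compute_class M Gamma n t s) <= 8 * ((size s).+1 * row_cost).
Proof.
move=> Gn; have ss : sorted ltn s := truncation_sorted n X.
have sn : {in s, forall x, x <= n}.
  by move=> x; rewrite mem_truncation => /andP[].
rewrite /compute_class /insert_gap /lookup !costE.
set T := value (generators _ _ _ s).
have [_ cT] := generators_spec ss sn; have Tm := generators_size ss sn.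
have [sub cZ] := syzygies_spec s Tm.
set Z := value (syzygies _ _ _ _ _) in sub *.
have sZ : sorted ltn Z := subseq_sorted ltn_trans sub ss.
have Zn : {in Z, forall x, x <= n} by move=> x /(mem_subseq sub)/sn.
have [_ cTZ] := generators_spec sZ Zn; have TZm := generators_size sZ Zn.
have le_Z := size_subseq sub.
have c_scan := scan_max_gap_cost (truncation n Gamma) s 0.
have c1 := count_below_cost (value (scan_max_gap M (truncation n Gamma) s 0))
  T 0.
have c2 := count_below_cost (value (scan_max_gap M (truncation n Gamma) s 0))
  (value (generators M Gamma n Z)) 0.
have au : arith_cost M <= u by rewrite /u /unit_cost; lia.
have mu : arith_cost M * n <= row_cost.
  by rewrite /row_cost leq_pmul2r// (leq_trans au)// leq_pmulr.
have {}c_scan := leq_trans c_scan (leq_mul Gn (leqnn _)).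
have r1 := units_row Tm au; have r2 := units_row TZm au.
have r0 : u <= row_cost by rewrite -[u]mul1n units_row.
have {}cTZ := leq_trans cTZ (leq_mul le_Z (leqnn _)).
have -> : 8 * ((size s).+1 * row_cost) = 8 * row_cost + 8 * (size s * row_cost).
  by rewrite -mulnDr -mulSn.
move: cT cZ cTZ c1 c2 c_scan r1; rewrite -/T !mulnDr.
move: (size s * row_cost) => q.
have : insert_cost M + lookup_cost M + arith_cost M <= u.
  rewrite /u /unit_cost; lia.
lia.
Qed.

(** If [d + g = x] with [d <> x] in [X] and [g] in [Gamma], then [d < x] and
    [x] would not be a minimal generator. *)
Lemma generator_removal l X x : semimodules Gamma l X ->
  x \in value (generators M Gamma n (truncation n X)) ->
  semimodules Gamma l.+1 (X `\ x)%classic /\ x \in truncation n X.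
Proof.
move=> [[XG XD] Xl] xT; set s := truncation n X in xT *.
have [|[[Ts minT _] _] _] := @generators_spec s (truncation_sorted n X).
  by move=> y; rewrite mem_truncation => /andP[].
have xs := Ts x xT; split=> //.
have := xs; rewrite mem_truncation => /andP[xn /asboolP Xx].
split; first split.
- by move=> y [/XG].
- move=> d g [Xd dx] Gg; split; first exact: XD.
  move=> /= dgx; have ds : d \in s.
    by rewrite mem_truncation (leq_trans _ xn) -?dgx ?leq_addr//; apply/asboolP.
  have [g0|g_gt0] := posnP g; first by case: dx; rewrite /= -dgx g0 addn0.
  have dx' : d < x by lia.
  by apply: (minT x d xT ds dx'); rewrite -dgx addKn.
apply/eq_cardSP; exists x; first by split; [exact: XG|move=> [_]; apply].
suff -> : ((Gamma `\` (X `\ x)) `\ x = Gamma `\` X)%classic by [].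
apply/seteqP; split=> y /=.
  by move=> [[Gy nXy] yx]; split=> // Xy; apply: nXy.
move=> [Gy nXy]; split; first by split=> // -[].
by move=> yx; apply: nXy; rewrite yx.
Qed.

(** * Levels of the tree *)

(** The size equation gives the factor [n - l] of the bound; the uniqueness
    together with the second half of the condition bounds the number of lists
    by [chi]. *)
Definition level_invariant (l : nat) (D : seq (seq nat)) : Prop :=
  uniq D /\ forall s, s \in D -> size s + l = size (truncation n Gamma) /\
    exists2 X, semimodules Gamma l X & s = truncation n X.

Definition level_cost (D : seq (seq nat)) :=
  \sum_(s <- D) (size s).+1 * row_cost.

Lemma insert_children_spec l X D' (s := truncation n X) :
  semimodules Gamma l X -> size s + l = size (truncation n Gamma) ->
  level_invariant l.+1 D' ->
  level_invariant l.+1 (value (insert_children M Gamma n D' s)) /\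
  cost (insert_children M Gamma n D' s) <= (size s).+1 * row_cost.
Proof.
move=> Xl sl inv.
have ss : sorted ltn s := truncation_sorted n X.
have sn : {in s, forall x, x <= n}.
  by move=> x; rewrite mem_truncation => /andP[].
have [_ cT] := generators_spec ss sn; have Tm := generators_size ss sn.
rewrite /insert_children value_bind cost_bind.
set T := value _ in Tm *.
have [||invT c] := @foldM_invariant _ _ (fun D'' x =>
    let! s' := delete_element M x s in insert_semimodule M D'' s')
  (fun _ D => level_invariant l.+1 D) (fun=> delete_cost M + insert_cost M)
  T D' => //.
  move=> p x r D TE [uD memD]; rewrite !costE; split=> //.
  have xT : x \in T by rewrite TE mem_cat mem_head orbT.
  have [X'l xs] := generator_removal Xl xT.
  rewrite !valueE; case: ifP => [//|sD]; split.
    by rewrite rcons_uniq sD.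
  move=> s'; rewrite mem_rcons inE => /predU1P[->|/memD//]; split.
    rewrite size_rem// addnS -addSn prednK//.
    by rewrite -has_predT; apply/hasP; exists x.
  by exists (X `\ x)%classic => //; rewrite truncation_setD1.
split=> //; rewrite mulSn addnC leq_add//.
rewrite big_const_seq count_predT iter_addn_0 mulnC in c.
apply: leq_trans c (units_row Tm _).
rewrite /u /unit_cost; lia.
Qed.

Lemma next_level_spec l D : level_invariant l D ->
  level_invariant l.+1 (value (next_level M Gamma n D)) /\
  cost (next_level M Gamma n D) <= level_cost D.
Proof.
move=> [uD memD]; apply: (@foldM_invariant _ _ _
  (fun _ D => level_invariant l.+1 D)); first by [].
move=> p s r D' DE inv; have [|sl [X Xl sE]] := memD s.
  by rewrite DE mem_cat mem_head orbT.
by rewrite sE in sl *; apply: insert_children_spec.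
Qed.

Lemma levels_from_spec j l D (r := levels_from M Gamma n j D) :
  level_invariant l D ->
  [/\ size (value r) = j.+1,
      forall i, i <= j -> level_invariant (l + i) (nth [::] (value r) i) &
      cost r <= \sum_(E <- value r) level_cost E].
Proof.
rewrite {}/r; elim: j l D => [|j IH] l D inv /=.
  by split=> // -[|//] _; rewrite addn0.
have [inv' c'] := next_level_spec inv; have [sz nthP c] := IH _ _ inv'.
rewrite !valueE; split=> /=; first by rewrite sz.
  by move=> [|i] ij; rewrite ?addn0// -addSnnS; apply: nthP.
by rewrite !costE big_cons addn0 leq_add.
Qed.

Lemma semimodules_maximal : semimodules Gamma 1 (Gamma `\ 0)%classic.
Proof.
split; first split; first by move=> x [].
  move=> d g [Gd d0] Gg; split; first exact: GammaD.
  by move=> /= /eqP; rewrite addn_eq0 => /andP[/eqP].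
apply/eq_cardSP; exists 0; first by split=> // -[_]; apply.
suff -> : ((Gamma `\` (Gamma `\ 0)) `\ 0 = set0)%classic by rewrite II0.
apply/seteqP; split=> x //= -[[Gx nx] x0]; apply: nx; split=> //.
Qed.


End Semigroup.

(** * Counting semimodules *)

(** A semimodule is determined by its gaps, a subset of [[0, n]]. *)
Lemma semimodules_finite Gamma l n :
  (forall Delta, semimodules Gamma l Delta ->
     (Gamma `\` Delta `<=` [set x | (x <= n)%N])%classic) ->
  finite_set (semimodules Gamma l).
Proof.
move=> small; pose f (X : {set 'I_n.+1}) : set nat :=
  (Gamma `\` [set x : nat | exists2 i : 'I_n.+1, i \in X & x = i])%classic.
apply: (@sub_finite_set _ _ (range f)).
  move=> Delta DG; have [[sub _] _] := DG; have gap := small _ DG.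
  exists [set i : 'I_n.+1 | `[< (Gamma `\` Delta)%classic (i : nat) >]]%SET.
    by [].
  apply/seteqP; split=> x.
    move=> [Gx nx]; apply: contrapT => nDx; apply: nx.
    have xn : x < n.+1 by apply: gap.
    by exists (Ordinal xn) => //; rewrite inE; apply/asboolP.
  move=> Dx; split; first exact: sub.
  by move=> -[i]; rewrite inE => /asboolP[_ nD] xi; apply: nD; rewrite -xi.
exact/finite_image/finite_finset.
Qed.

Lemma level_size Gamma l n D : finite_set (semimodules Gamma l) ->
  level_invariant Gamma n l D -> size D <= chi Gamma l.
Proof.
move=> fin [uD memD]; rewrite /chi -(size_map (truncation n)).
apply: uniq_leq_size => // s /memD[_ [X Xl ->]].
by apply: map_f; rewrite in_fset_set//; apply: mem_set.
Qed.

(** Each residue class modulo [c] contains exactly one element of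
    [Gamma \ (c + Gamma)], namely its least element in [Gamma]; for the
    residue [r < c] this is [r] or [c + r], because all numbers from [c] on
    are in [Gamma]. *)
Lemma semimodule_conductor (Gamma : set nat) c :
  (forall x y, Gamma x -> Gamma y -> Gamma (x + y)) ->
  (forall x, c <= x -> Gamma x) ->
  semimodules Gamma c [set c + g | g in Gamma]%classic.
Proof.
move=> GammaD Gc; split; first split.
- by move=> _ [g Gg <-]; apply: Gc; rewrite leq_addr.
- by move=> _ g [h Gh <-] Gg; exists (h + g); [exact: GammaD|rewrite addnA].
pose f r := if `[< Gamma r >] then r else c + r.
have -> : (Gamma `\` [set c + g | g in Gamma] = f @` `I_c)%classic.
  apply/seteqP; split=> x /=.
    move=> [Gx nx]; have [xc|cx] := ltnP x c.
      by exists x => //; rewrite /f asboolT.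
    have nG : ~ Gamma (x - c).
      by move=> h; apply: nx; exists (x - c); rewrite ?subnKC.
    exists (x - c); last by rewrite /f asboolF// subnKC.
    by rewrite /= ltnNge; apply/negP => /Gc.
  move=> [r rc <-]; rewrite /f; case: asboolP => Gr; split=> //.
  - by move=> [g _ gr]; move: rc; rewrite /= -gr ltnNge leq_addr.
  - by apply: Gc; rewrite leq_addr.
  - by move=> [g Gg /addnI gr]; apply: Gr; rewrite -gr.
apply: inj_card_eq => r s /set_mem /= rc /set_mem /= sc.
rewrite /f; case: asboolP => _; case: asboolP => _ //; lia.
Qed.

(** The number [0] is an empty combination, so it is never a minimal
    generator. *)
Lemma multiplicity_gt0 (Gamma : set nat) alpha :
  minimal_generators alpha Gamma -> Gamma <> [set 0]%classic ->
  0 < head 0 alpha /\ Gamma (head 0 alpha).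
Proof.
case=> srt -> minA; case: alpha srt minA => [|a s] srt minA neq0.
  case: neq0; apply/seteqP; split=> x /=; first by case=> k; rewrite big_nil.
  by move=> ->; exists id; rewrite big_nil.
have : uniq (a :: s) by apply: sorted_uniq ltn_trans ltnn _ srt.
rewrite /= => /andP[nas _]; split.
  rewrite lt0n; apply/eqP => a0; apply: (minA a); first exact: mem_head.
  by rewrite a0; exists (fun=> 0); rewrite big1.
exists (fun x => x == a : nat); rewrite big_cons eqxx mul1n.
rewrite big_seq big1 ?addn0//.
by move=> x xs; case: eqP => // xa; move: nas; rewrite -xa xs.
Qed.

Lemma size_truncation_proper (Gamma : set nat) n :
  0 < n -> ~ Gamma 1 -> size (truncation n Gamma) <= n.
Proof.
move=> n0 n1; rewrite -[leqRHS]/(n.+1.-1) -[in leqRHS](size_iota 0 n.+1).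
rewrite -(@size_rem _ 1) ?mem_iota//; apply: uniq_leq_size.
  by rewrite filter_uniq ?iota_uniq.
move=> x; rewrite mem_filter => /andP[/asboolP Gx xi].
rewrite mem_rem_uniq ?iota_uniq// inE xi andbT.
by apply/eqP => x1; case: n1; rewrite -x1.
Qed.

(** * Total cost *)

Section Cost.
Variables (Gamma : set nat) (M : cost_model) (k m n c : nat).
Hypothesis Gamma0 : Gamma 0.
Hypothesis GammaD : forall x y, Gamma x -> Gamma y -> Gamma (x + y).
Hypothesis test_le : forall j, test_cost M j <= k * j.
Hypothesis m_gt0 : 0 < m.
Hypothesis Gamma_m : Gamma m.
Hypothesis n_gt0 : 0 < n.
Hypothesis Gamma_n : size (truncation n Gamma) <= n.
Hypothesis c_gt0 : 0 < c.

Lemma tree_spec (levels := tree M Gamma c n) :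
  [/\ size (value levels) = c,
      forall l, 0 < l <= c ->
        level_invariant Gamma n l (nth [::] (value levels) l.-1) &
      cost levels <= 2 * unit_cost M k +
        \sum_(D <- value levels) level_cost M k m n D].
Proof.
rewrite {}/levels /tree /delete_element /insert_semimodule !valueE !costE /=.
have G0 : 0 \in truncation n Gamma.
  by rewrite mem_truncation leq0n; apply/asboolP.
have inv : level_invariant Gamma n 1 [:: rem 0 (truncation n Gamma)].
  split=> // s; rewrite inE => /eqP->; split.
    rewrite size_rem// addn1 prednK// -has_predT; apply/hasP; by exists 0.
  exists (Gamma `\ 0)%classic; first exact: semimodules_maximal.
  by rewrite truncation_setD1.
have [sz nthP c_le] :=
  levels_from_spec Gamma0 GammaD test_le m_gt0 Gamma_m n_gt0 c.-1 inv.
split; first by rewrite sz prednK.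
  by move=> [|l] // /andP[_ lc]; have := nthP l; rewrite add1n; apply; lia.
by rewrite addnA leq_add// /unit_cost; lia.
Qed.

Lemma all_classes_cost (levels : seq (seq (seq nat))) :
  (forall D s, D \in levels -> s \in D -> exists X, s = truncation n X) ->
  cost (all_classes M Gamma n levels) <=
    unit_cost M k + 8 * \sum_(D <- levels) level_cost M k m n D.
Proof.
move=> trunc; rewrite /all_classes !costE leq_add//.
  by rewrite /unit_cost; lia.
rewrite big_distrr; apply: foldM_cost => t D DL.
rewrite /level_cost big_distrr; apply: foldM_cost => t' s sD.
by have [X ->] := trunc D s DL sD; apply: compute_class_cost.
Qed.

Lemma sum_levels_cost t levels :
  cost (sum_levels M t levels) <=
    size levels * unit_cost M k + \sum_(D <- levels) level_cost M k m n D.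
Proof.
have -> : size levels * unit_cost M k = \sum_(D <- levels) unit_cost M k.
  by rewrite big_const_seq count_predT iter_addn_0 mulnC.
rewrite -big_split; apply: foldM_cost => r D _; rewrite !costE addnC leq_add//.
  by rewrite /unit_cost; lia.
apply: foldM_cost => x s _; rewrite /lookup !costE mulSn.
apply: leq_trans (leq_addr _ _); rewrite /row_cost -mulnA.
apply: (@leq_trans (unit_cost M k)); first by rewrite /unit_cost; lia.
by rewrite leq_pmulr// muln_gt0 m_gt0.
Qed.

(** The constant [24]: the semimodules take [10] times the sum of the
    [level_cost], which is at most twice [unit_cost] times the sum on the right
    (the factor two comes from [size s + 1 <= 2 * (n - l)]), and the remaining
    [(c + 3) * unit_cost] is at most [4 * c * unit_cost]. *)
Lemma zeta_algorithm_cost :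
  (forall l, 0 < l <= c -> finite_set (semimodules Gamma l)) -> c < n ->
  cost (zeta_algorithm M Gamma c n) <=
    24 * unit_cost M k *
      \sum_(1 <= l < c.+1) c * chi Gamma l * n * m * (n - l).
Proof.
move=> fin lt_cn.
rewrite /zeta_algorithm cost_bind [cost (bind (all_classes _ _ _ _) _)]cost_bind.
have [sz inv c_tree] := tree_spec.
set levels := value (tree _ _ _ _) in sz inv c_tree *.
have c_classes : cost (all_classes M Gamma n levels) <=
    unit_cost M k + 8 * \sum_(D <- levels) level_cost M k m n D.
  apply: all_classes_cost => D s DL.
  have iD := DL; rewrite -index_mem sz in iD.
  have [|_ memD] := inv (index D levels).+1; first by rewrite iD.
  rewrite /= nth_index// in memD.
  by move=> /memD[_ [X _ ->]]; exists X.
have c_sum := sum_levels_cost (value (all_classes M Gamma n levels)) levels.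
rewrite sz in c_sum.
set u := unit_cost M k in c_tree c_classes c_sum *.
set S := \sum_(D <- levels) _ in c_tree c_classes c_sum.
set R := \sum_(1 <= l < c.+1) _.
have size_chi l : 0 < l <= c -> size (nth [::] levels l.-1) <= chi Gamma l.
  by move=> lc; apply: level_size (fin l lc) (inv l lc).
have S_le : S <= 2 * u * R.
  rewrite /S (big_nth [::]) sz /R big_add1 /= big_distrr /=.
  rewrite big_nat [leqRHS]big_nat; apply: leq_sum => i /andP[_ ic].
  have [uD memD] := inv i.+1 ic; have sD := size_chi i.+1 ic.
  rewrite /= in uD memD sD; set D := nth [::] levels i in uD memD sD *.
  apply: (@leq_trans (size D * (2 * (n - i.+1) * (u * m * n)))).
    rewrite /level_cost -[size D]count_predT mulnC -iter_addn_0 -big_const_seq.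
    rewrite big_seq [leqRHS]big_seq; apply: leq_sum => s /memD[sl _].
    by rewrite leq_mul2r; apply/orP; right; lia.
  have sDc : size D <= c * chi Gamma i.+1.
    by apply: leq_trans sD _; rewrite leq_pmull.
  apply: leq_trans (leq_mul sDc (leqnn _)) _.
  by apply: eq_leq; lia.
(* The term [l = 1] alone is a nonzero multiple of [c]. *)
have R_ge : c <= R.
  rewrite /R big_ltn//; apply: leq_trans (leq_addr _ _).
  have chi1 : 0 < chi Gamma 1.
    rewrite /chi cardfs_gt0; apply/fset0Pn; exists (Gamma `\ 0)%classic.
    by rewrite in_fset_set; [exact/mem_set/semimodules_maximal|exact: fin].
  rewrite -!mulnA leq_pmulr// !muln_gt0 chi1 n_gt0 m_gt0 subn_gt0.
  exact: leq_ltn_trans c_gt0 lt_cn.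
have := leq_mul (leqnn u) R_ge.
have := leq_mul (leqnn u) c_gt0.
nia.
Qed.
End Cost.

Theorem theorem5p5 (M : cost_model) :
  exists K : nat,
    forall (Gamma : set nat) (alpha : seq nat) (c n : nat),
      numerical_semigroup Gamma ->
      Gamma <> setT ->
      minimal_generators alpha Gamma ->
      (monomial_semigroup Gamma \/
       exists a1 a2 : nat, alpha = [:: a1; a2] /\ coprime a1 a2) ->
      is_conductor Gamma c ->
      suffices M Gamma c n ->
      cost (zeta_algorithm M Gamma c n) <=
        K * \sum_(1 <= l < c.+1) c * chi Gamma l * n * head 0 alpha * (n - l).
Proof.
have [k test_le] := test_cost_linear M; exists (24 * unit_cost M k).
move=> Gamma alpha c n [Gamma0 GammaD _] GammaT gens _ [Gc cmin] [small _].
have n1 : ~ Gamma 1.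
  move=> G1; apply: GammaT; apply/seteqP; split=> // x _.
  by rewrite -[x]muln1; apply: semigroup_muln.
have c_gt1 : 1 < c by rewrite ltnNge; apply/negP => /Gc.
have [m_gt0 Gamma_m] : 0 < head 0 alpha /\ Gamma (head 0 alpha).
  apply: multiplicity_gt0 gens _ => G0.
  by have := Gc c (leqnn c); rewrite G0 /=; lia.
have fin l : 0 < l <= c -> finite_set (semimodules Gamma l).
  by move=> lc; apply: (@semimodules_finite _ _ n) => Delta; apply: small.
have nGc : ~ Gamma c.-1.
  move=> Gc1; have : c <= c.-1; last by lia.
  apply: cmin => x xc; have [/Gc//|xc'] := leqP c x.
  by have -> : x = c.-1 by lia.
(* [c + (c - 1)] is a gap of the semimodule [c + Gamma]. *)
have c_n : c + c.-1 <= n.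
  apply: small (semimodule_conductor GammaD Gc) _ _; first by lia.
  split; first by apply: Gc; rewrite leq_addr.
  by move=> [g Gg /addnI gc]; apply: nGc; rewrite -gc.
have n_gt0 : 0 < n by lia.
by apply: zeta_algorithm_cost => //; [exact: size_truncation_proper|lia|lia].
Qed.
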